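(* If $G$ is a graph of order $n$ and chromatic number $l$, and $G$ is not isomorphic to the Turán graph $T_{n,l}$, then $$\eta(G) < \eta(T_{n,l}).$$
   Context: All graphs are finite and simple (undirected, no loops or multiple edges), have at least one vertex, and are not assumed connected. The order of $G$ is $|V(G)|$. For a graph $G$, $\eta(G)$ denotes the number of connected induced subgraphs of $G$, i.e. the number of nonempty subsets $S\subseteq V(G)$ such that the subgraph of $G$ induced by $S$ is connected. The chromatic number of $G$ is the minimum number of colours needed to colour the vertices so that adjacent vertices have different colours. The Turán graph $T_{n,l}$ ($1\le l\le n$) is the complete $l$-partite graph of order $n$ in which any two partition sets differ in cardinality by at most one. *)

(* Defs.v *)
From mathcomp Require Import all_boot.

Set Implicit Arguments.
Unset Strict Implicit.
Unset Printing Implicit Defensive.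

Record sgraph := SGraph {
  vertex :> finType;
  adj : rel vertex;
  adj_sym : symmetric adj;
  adj_irrefl : irreflexive adj;
  vertex_gt0 : 0 < #|vertex|
}.

Definition order_of (G : sgraph) : nat := #|G|.

Definition isomorphic (G H : sgraph) : Prop :=
  exists2 f : G -> H, bijective f & forall x y, adj (f x) (f y) = adj x y.

Definition induced_adj (G : sgraph) (S : {set G}) : rel G :=
  [rel x y | [&& x \in S, y \in S & adj x y]].

(* [connect] lives on all of G, but between two vertices of S the paths of
   [induced_adj S] are exactly the paths of the subgraph induced by S. *)
Definition connected_induced (G : sgraph) (S : {set G}) : bool :=
  [forall x in S, forall y in S, connect (induced_adj S) x y].

Definition eta (G : sgraph) : nat :=
  #|[set S : {set G} | (S != set0) && connected_induced S]|.

Definition proper_coloring (G : sgraph) (k : nat) (c : {ffun G -> 'I_k}) :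
    bool :=
  [forall x, forall y, adj x y ==> (c x != c y)].

Definition colorable (G : sgraph) (k : nat) : bool :=
  [exists c : {ffun G -> 'I_k}, proper_coloring c].

Lemma colorable_ex (G : sgraph) : exists k, colorable G k.
Proof.
exists #|G|; apply/existsP; exists [ffun x => enum_rank x].
apply/forallP=> x; apply/forallP=> y; apply/implyP=> xy; rewrite !ffunE.
by apply/eqP=> /enum_rank_inj exy; rewrite exy adj_irrefl in xy.
Qed.

Definition chromatic_number (G : sgraph) : nat := ex_minn (colorable_ex G).

(* [partition] excludes empty blocks, so P has exactly l nonempty parts. *)
Definition complete_multipartite (G : sgraph) (l : nat) (P : {set {set G}}) :
    Prop :=
  [/\ partition P [set: G], #|P| = l &
      forall x y : G, adj x y = (pblock P x != pblock P y)].

(* The Turan graph is only determined up to isomorphism, so it is given as a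
   predicate; [turan_exists] shows that it is inhabited when 1 <= l <= n. *)
Definition is_turan (n l : nat) (T : sgraph) : Prop :=
  order_of T = n /\
  exists2 P : {set {set T}}, complete_multipartite l P &
    forall A B : {set T}, A \in P -> B \in P -> #|A| <= #|B|.+1.

Lemma turan_exists (n l : nat) : 0 < l <= n -> exists T, is_turan n l T.
Proof.
case/andP=> l0 ln.
pose e (i j : 'I_n) := i %% l != j %% l.
have esym : symmetric e by move=> i j; rewrite /e eq_sym.
have eirr : irreflexive e by move=> i; rewrite /e eqxx.
have n0 : 0 < #|'I_n| by rewrite card_ord (leq_trans l0 ln).
exists (SGraph esym eirr n0); split; first by rewrite /order_of card_ord.
pose B (r : 'I_l) : {set 'I_n} := [set i : 'I_n | i %% l == r].
pose rl (i : 'I_n) : 'I_l := Ordinal (ltn_pmod i l0).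
have inB i r : (i \in B r) = (rl i == r) by rewrite inE -val_eqE.
have Bne r : exists i, i \in B r.
  exists (Ordinal (leq_trans (ltn_ord r) ln)); rewrite inE /=.
  by rewrite modn_small.
have Binj : injective B.
  move=> r s; have [i ir] := Bne r; move=> Brs; move: (ir); rewrite Brs.
  by move: ir; rewrite !inB => /eqP-> /eqP.
have trivP : trivIset (B @: [set: 'I_l]).
  apply/trivIsetP=> _ _ /imsetP[r _ ->] /imsetP[s _ ->] rs.
  rewrite -setI_eq0; apply/eqP/setP=> i; rewrite in_setI !inB in_set0.
  by apply/andP=> -[/eqP ir /eqP is_]; case/eqP: rs; rewrite -ir -is_.
have pbl i : pblock (B @: [set: 'I_l]) i = B (rl i).
  by apply: def_pblock; rewrite ?inB // imset_f.
exists (B @: [set: 'I_l]).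
  split.
  - apply/and3P; split=> //.
      rewrite eqEsubset subsetT; apply/subsetP=> i _.
      by apply/bigcupP; exists (B (rl i)); rewrite ?inB ?imset_f.
    by apply/imsetP=> -[r _ r0]; have [i] := Bne r; rewrite -r0 in_set0.
  - by rewrite card_imset // cardsT card_ord.
  - by move=> i j; rewrite !pbl (inj_eq Binj) -val_eqE.
move=> _ _ /imsetP[r _ ->] /imsetP[s _ ->].
pose i0 := Ordinal (leq_trans (ltn_ord r) ln).
have i0B : i0 \in B r by rewrite inE /= modn_small.
rewrite (cardsD1 i0) i0B add1n ltnS.
have ge1 i : i \in B r :\ i0 -> 0 < i %/ l.
  rewrite !inE => /andP[ni0 /eqP ir]; rewrite divn_gt0 // leqNgt.
  apply: contra ni0 => il; rewrite -val_eqE /= -ir modn_small //.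
have lt_n i : i \in B r :\ i0 -> (i %/ l).-1 * l + s < n.
  move/ge1=> q0; apply: leq_ltn_trans (ltn_ord i).
  apply: leq_trans (leq_divM i l); rewrite -{2}(prednK q0) mulSn addnC.
  by rewrite leq_add2r ltnW.
pose f (i : 'I_n) : 'I_n := insubd i0 ((i %/ l).-1 * l + s).
have fE i : i \in B r :\ i0 -> f i = (i %/ l).-1 * l + s :> nat.
  by move=> iB; rewrite /f val_insubd lt_n.
rewrite -(@card_in_imset _ _ f); last first.
  move=> i j iB jB /(congr1 val); rewrite /= fE // fE // => /addIn/eqP.
  rewrite eqn_pmul2r // => /eqP eq1; apply: val_inj => /=.
  have eqq : i %/ l = j %/ l by rewrite -(prednK (ge1 _ iB)) eq1 prednK ?ge1.
  move: iB jB; rewrite !inE => /andP[_ /eqP ir] /andP[_ /eqP jr].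
  by rewrite (divn_eq i l) (divn_eq j l) eqq ir jr.
apply/subset_leq_card/subsetP=> _ /imsetP[i iB ->].
by rewrite inE fE // modnMDl modn_small.
Qed.

(* Main.v *)
Require Import Defs.
From mathcomp Require Import all_boot.
From mathcomp Require Import zify.

(** A proper colouring of [G] with [l] classes of sizes [a_k] makes every
    monochromatic set with at least two vertices disconnected, so
    [eta G <= 2 ^ n - 1 + l + n - \sum_k 2 ^ a_k], with equality exactly when
    [G] is complete multipartite on the colour classes. The tangent-line
    inequality for [2 ^ a] at [q], an equality only at [a = q] and [a = q.+1],
    shows that [\sum_k 2 ^ a_k] is minimal exactly for balanced classes. *)

Set Implicit Arguments.
Unset Strict Implicit.
Unset Printing Implicit Defensive.

(** * Colour classes and colour-preserving bijections *)

Definition color_class (V K : finType) (c : V -> K) (k : K) : {set V} :=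
  [set x | c x == k].

Lemma sum_card_color_class (V K : finType) (c : V -> K) :
  \sum_k #|color_class c k| = #|V|.
Proof.
rewrite -sum1_card (partition_big c predT) //=; apply: eq_bigr => k _.
by rewrite -sum1_card; apply: eq_bigl => x; rewrite inE.
Qed.

(** Each class of [c] is enumerated and its i-th element sent to the i-th element of the equally
    large class of [d]; [y0] is the default value of [nth]. *)
Lemma color_preserving_bijection (V W K : finType) (c : V -> K) (d : W -> K)
    (y0 : W) :
    (forall k, #|color_class c k| = #|color_class d k|) ->
  exists2 f : V -> W, bijective f & forall x, d (f x) = c x.
Proof.
move=> cd.
pose f x :=
  nth y0 (enum (color_class d (c x))) (index x (enum (color_class c (c x)))).
have idx x : index x (enum (color_class c (c x)))
    < size (enum (color_class d (c x))).
  by rewrite -cardE -cd cardE index_mem mem_enum inE.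
have df x : d (f x) = c x.
  by have := mem_nth y0 (idx x); rewrite mem_enum inE => /eqP.
exists f => //; apply: inj_card_bij; last first.
  rewrite -(sum_card_color_class d) -(sum_card_color_class c).
  by apply: leq_sum => k _; rewrite cd.
move=> x y fxy; have cxy : c x = c y by rewrite -!df fxy.
move: fxy (idx x); rewrite /f cxy => /eqP fxy ix.
rewrite (nth_uniq _ ix (idx y) (enum_uniq _)) in fxy.
have xin : x \in enum (color_class c (c y)) by rewrite mem_enum inE cxy.
by have := nth_index x xin; rewrite (eqP fxy) nth_index // mem_enum inE.
Qed.

(** * Counting the sets that can be connected *)

Definition monochromatic (V K : finType) (c : V -> K) (S : {set V}) : bool :=
  [exists k, S \subset color_class c k].

Definition multicolored (V K : finType) (c : V -> K) : {set {set V}} :=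
  [set S | (S != set0) && (monochromatic c S ==> (#|S| == 1))].

Lemma card_powerset_split (V : finType) (A : {set V}) :
  2 ^ #|A| = 1 + #|A| + #|[set S : {set V} | (S \subset A) && (1 < #|S|)]|.
Proof.
rewrite -card_powerset -(cardsID [set S : {set V} | 1 < #|S|]) addnC.
congr (_ + _); last by apply: eq_card => S; rewrite !inE.
rewrite -(cardsID [set S : {set V} | #|S| == 0]).
congr (_ + _).
  by rewrite -[RHS](bin0 #|A|) -cards_draws; apply: eq_card => S; rewrite !inE;
    case: (S \subset A); case: #|S| => [|[|]].
by rewrite -[RHS](bin1 #|A|) -cards_draws; apply: eq_card => S; rewrite !inE;
  case: (S \subset A); case: #|S| => [|[|]].
Qed.

(** The sets left out are the empty set and, for each class of size [a], its [2 ^ a - 1 - a] subsets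
    with at least two elements. Terms are moved across so that no subtraction occurs. *)
Lemma card_multicolored (V K : finType) (c : V -> K) :
  #|multicolored c| + 1 + \sum_k 2 ^ #|color_class c k| =
  2 ^ #|V| + #|K| + #|V|.
Proof.
under eq_bigr do rewrite card_powerset_split.
rewrite !big_split /= sum_nat_const muln1 sum_card_color_class.
pose D k := [set S : {set V} | (S \subset color_class c k) && (1 < #|S|)].
have disj k1 k2 S : S \in D k1 -> S \in D k2 -> k1 = k2.
  rewrite !inE => /andP[/subsetP s1 S1] /andP[/subsetP s2 _].
  have /card_gt0P[x xS] : 0 < #|S| by apply: ltnW.
  by have := s1 x xS; have := s2 x xS; rewrite !inE => /eqP-> /eqP.
have sumD : \sum_k #|D k| = #|\bigcup_k D k|.
  rewrite -sum1_card partition_disjoint_bigcup => [|k1 k2 k12].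
    by apply: eq_bigr => k _; rewrite sum1_card.
  rewrite -setI_eq0; apply/eqP/setP=> S; rewrite in_setI in_set0.
  by apply/andP=> -[/disj + /[dup] S2] => /(_ _ S2) E; rewrite E eqxx in k12.
have splitV : #|multicolored c| + 1 + #|\bigcup_k D k| = 2 ^ #|V|.
  have -> : 2 ^ #|V| = #|{set V}| by rewrite -!cardsT -powersetT card_powerset.
  rewrite -[RHS](cardsC (multicolored c)) -addnA; congr (_ + _).
  (* The summand 1 counts the empty set, which lies in no [D k]; the sum thus becomes the
     cardinality of a disjoint union. *)
  rewrite -(cards1 (set0 : {set V})) -cardsUI.
  rewrite [X in _ + X](_ : _ = 0) ?addn0; last first.
    apply/eqP; rewrite cards_eq0; apply/eqP/setP=> S; rewrite !inE.
    apply/andP=> -[/eqP-> /bigcupP[k _]].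
    by rewrite inE cards0 andbF.
  apply: eq_card => S; rewrite !inE negb_and negbK negb_imply.
  have [-> //|S0] := eqVneq S set0; rewrite /=.
  have S_gt0 : 0 < #|S| by rewrite card_gt0.
  apply/bigcupP/andP=> [[k _]|[/existsP[k Sk] S1]].
    rewrite inE => /andP[Sk S1]; split; last by rewrite neq_ltn S1 orbT.
    by apply/existsP; exists k.
  by exists k; rewrite // inE Sk; lia.
rewrite -[X in _ + (_ + X)]/(\sum_k #|D k|) sumD.
by rewrite -splitV -[RHS]addnA -[RHS]addnA [#|\bigcup_k D k| + _]addnC.
Qed.

(** * Connected sets against multicoloured sets *)

Definition connected_sets (G : sgraph) : {set {set G}} :=
  [set S : {set G} | (S != set0) && connected_induced S].

(** A path between two distinct vertices of a monochromatic set would start with a monochromatic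
    edge. *)
Lemma connected_sets_sub_multicolored (G : sgraph) (K : finType) (c : G -> K) :
    (forall x y, adj x y -> c x != c y) ->
  connected_sets G \subset multicolored c.
Proof.
move=> cP; apply/subsetP=> S; rewrite !inE => /andP[S0 Sc]; rewrite S0 /=.
apply/implyP=> /existsP[k /subsetP Sk].
have S_gt0 : 0 < #|S| by rewrite card_gt0.
rewrite eqn_leq S_gt0 andbT leqNgt; apply/negP=> /card_gt1P[x [y [xS yS xy]]].
have /forall_inP/(_ x xS)/forall_inP/(_ y yS)/connectP[[|z p]] := Sc.
  by move=> _ yx; rewrite yx eqxx in xy.
rewrite /= => /andP[/and3P[_ zS /cP xz] _] _.
have := Sk x xS; have := Sk z zS; rewrite !inE => /eqP cz /eqP cx.
by rewrite cx cz eqxx in xz.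
Qed.

(** Vertices of different colours are adjacent; two of the same colour are joined through a vertex
    [z] of another colour. *)
Lemma multicolored_sub_connected_sets (G : sgraph) (K : finType) (c : G -> K) :
    (forall x y, c x != c y -> adj x y) ->
  multicolored c \subset connected_sets G.
Proof.
move=> cP; apply/subsetP=> S; rewrite !inE => /andP[S0 Sc]; rewrite S0 /=.
have edge x y : x \in S -> y \in S -> c x != c y ->
    connect (induced_adj S) x y.
  by move=> xS yS /cP xy; apply: connect1; rewrite /induced_adj /= xS yS.
apply/forall_inP=> x xS; apply/forall_inP=> y yS.
have [mS|] := boolP (monochromatic c S).
  move: Sc; rewrite mS => /cards1P[z Sz].
  by move: xS yS; rewrite Sz !inE => /eqP-> /eqP->; apply: connect0.
rewrite negb_exists => /forallP/(_ (c x))/subsetPn[z zS]; rewrite inE => zx.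
have [cxy|/edge] := eqVneq (c x) (c y); last exact.
apply: (@connect_trans _ _ z); apply: edge => //; first by rewrite eq_sym.
by rewrite -cxy.
Qed.

(** * Convexity of powers of two and balanced sizes *)

(** Divided by [2 ^ q], this is [1 + d <= 2 ^ d] for the signed difference [d = a - q], with
    equality only at 0 and 1. *)
Lemma exp2_tangent (q a : nat) : 2 ^ q + a * 2 ^ q <= 2 ^ a + q * 2 ^ q
   ?= iff ((a == q) || (a == q.+1)).
Proof.
have [aq|qa] := ltnP a q.
  have -> : q = a + (q - a).-1.+1 by lia.
  move: (q - a).-1 => d; rewrite expnD expnS.
  have : 0 < 2 ^ a by rewrite expn_gt0.
  have : d < 2 ^ d by apply: ltn_expl.
  by move=> H1 H2; apply/leqifP; rewrite ifN; nia.
have -> : a = q + (a - q) by lia.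
move: (a - q) => d; rewrite expnD.
have q_gt0 : 0 < 2 ^ q by rewrite expn_gt0.
apply/leqifP; case: d => [|[|d]]; [by rewrite ifT; nia .. |].
rewrite ifN; last by lia.
have : d.+1 < 2 ^ d.+1 by apply: ltn_expl.
rewrite [2 ^ d.+2]expnS; nia.
Qed.

(** The lower bound depends on [a] only through its sum, so families with the same index count and
    total can be compared. *)
Lemma sum_exp2_tangent (K : finType) (a : K -> nat) (q : nat) :
  (#|K| + \sum_k a k) * 2 ^ q <= \sum_k 2 ^ a k + #|K| * q * 2 ^ q
     ?= iff [forall k, (a k == q) || (a k == q.+1)].
Proof.
have := leqif_sum (fun k (_ : predT k) => exp2_tangent q (a k)).
by rewrite !big_split /= !sum_nat_const -big_distrl /= mulnDl mulnA.
Qed.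

Lemma card_succ_balanced (K : finType) (a : K -> nat) (q : nat) :
    (forall k, (a k == q) || (a k == q.+1)) ->
  #|K| * q + #|[set k | a k == q.+1]| = \sum_k a k.
Proof.
move=> aq; pose E := [set k | a k == q.+1].
have -> : #|K| * q = \sum_(k : K) q by rewrite sum_nat_const.
have -> : #|E| = \sum_k (k \in E) by rewrite -sum1_card big_mkcond.
rewrite -big_split; apply: eq_bigr => k _; rewrite inE /=.
by have := aq k; lia.
Qed.

(** The total determines how many entries equal [q.+1], so the indices can be matched as a
    two-colouring by that test. *)
Lemma balanced_reindexing (K L : finType) (a : K -> nat) (b : L -> nat)
    (q : nat) (y0 : L) :
    #|K| = #|L| -> \sum_k a k = \sum_k b k ->
    (forall k, (a k == q) || (a k == q.+1)) ->
    (forall k, (b k == q) || (b k == q.+1)) ->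
  exists2 s : K -> L, bijective s & forall k, b (s k) = a k.
Proof.
move=> KL ab aq bq.
have eqT : #|[set k | a k == q.+1]| = #|[set k | b k == q.+1]|.
  apply/eqP; rewrite -(eqn_add2l (#|K| * q)) card_succ_balanced // KL.
  by rewrite card_succ_balanced // ab.
have classT (M : finType) (m : M -> nat) :
    color_class (fun k => m k == q.+1) true = [set k | m k == q.+1].
  by apply/setP=> k; rewrite !inE eqb_id.
have classF (M : finType) (m : M -> nat) :
    color_class (fun k => m k == q.+1) false = ~: [set k | m k == q.+1].
  by apply/setP=> k; rewrite !inE eqbF_neg.
have [|s sb sP] := @color_preserving_bijection K L bool
    (fun k => a k == q.+1) (fun k => b k == q.+1) y0.
  case; first by rewrite !classT.
  by rewrite !classF cardsCs [RHS]cardsCs !setCK eqT KL.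
exists s => // k; have := sP k; have := aq k; have := bq (s k); lia.
Qed.

Lemma sizes_within_one (K : finType) (b : K -> nat) (k0 : K) :
    (forall i j, b i <= (b j).+1) ->
  exists q, forall k, (b k == q) || (b k == q.+1).
Proof.
move=> bP; case: (arg_minnP b (isT : predT k0)) => m _ mP.
by exists (b m) => k; have := mP k isT; have := bP k m; lia.
Qed.

(** The parts themselves, taken as a subtype, serve as colours. *)
Lemma complete_multipartite_coloring (G : sgraph) (l : nat)
    (P : {set {set G}}) : complete_multipartite l P ->
  exists K : finType, exists2 d : G -> K,
    #|K| = l /\ (forall x y, adj x y = (d x != d y)) &
    forall k, color_class d k \in P.
Proof.
case=> /and3P[/eqP covP trivP P0] cardP adjP.
have inP x : pblock P x \in P by rewrite pblock_mem // covP inE.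
exists {A : {set G} | A \in P}, (fun x => Sub (pblock P x) (inP x)).
  by split=> [|x y]; rewrite ?card_sig // adjP -val_eqE.
case=> A AP; suff -> : color_class (fun x => Sub (pblock P x) (inP x))
    (exist _ A AP) = A by [].
apply/setP=> x; rewrite inE -val_eqE /=; apply/eqP/idP=> [<-|].
  by rewrite mem_pblock covP inE.
exact: def_pblock.
Qed.

Lemma chromatic_coloring (G : sgraph) :
  exists c : G -> 'I_(chromatic_number G),
    forall x y, adj x y -> c x != c y.
Proof.
rewrite /chromatic_number; case: ex_minnP => k /existsP[c /forallP cP] _.
by exists c => x y; have /forallP/(_ y)/implyP := cP x.
Qed.

(** * Comparison with the Turán graph *)

Theorem theorem2p4 (n l : nat) (G T : sgraph)
    (hn : order_of G = n) (hl : chromatic_number G = l)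
    (hT : is_turan n l T) (hGT : ~ isomorphic G T) :
  eta G < eta T.
Proof.
have [c cP] := chromatic_coloring G.
have [hnT [P /complete_multipartite_coloring[K [d [cardK dP] inP]] bal]] := hT.
have /card_gt0P[y0 _] := vertex_gt0 T.
have [q bq] := @sizes_within_one K (fun k => #|color_class d k|) (d y0)
  (fun i j => bal _ _ (inP i) (inP j)).
have cardGT : #|G| = #|T| by rewrite -[LHS]/(order_of G) hn -hnT.
have cardKL : #|'I_(chromatic_number G)| = #|K| by rewrite card_ord hl cardK.
have etaT : eta T = #|multicolored d|.
  apply/eqP; rewrite eqn_leq.
  have -> /= : eta T <= #|multicolored d|.
    apply: subset_leq_card; apply: connected_sets_sub_multicolored => x y.
    by rewrite dP.
  apply: subset_leq_card; apply: multicolored_sub_connected_sets => x y.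
  by rewrite dP.
have subG := connected_sets_sub_multicolored cP.
have etaG : eta G <= #|multicolored c| by apply: subset_leq_card.
have cardc := card_multicolored c; have cardd := card_multicolored d.
have tanc := sum_exp2_tangent (fun k => #|color_class c k|) q.
have tand := sum_exp2_tangent (fun k => #|color_class d k|) q.
rewrite !sum_card_color_class in tanc tand.
have {}tand : (#|K| + #|T|) * 2 ^ q =
    \sum_k 2 ^ #|color_class d k| + #|K| * q * 2 ^ q.
  by apply/eqP; rewrite tand; apply/forallP.
(* The bound is attained by [T], so its left side in [tanc] becomes the power sum of [T], up to the
   common term. *)
rewrite cardKL cardGT tand in tanc; rewrite cardGT cardKL in cardc.
have le_sum : \sum_k 2 ^ #|color_class d k| <= \sum_k 2 ^ #|color_class c k|.
  by have := leqif_geq tanc; have [+ _] := tanc; rewrite leq_add2r.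
(* Assuming [eta T <= eta G], every inequality above becomes an equality, which forces an
   isomorphism. *)
rewrite ltnNge; apply/negP=> le_eta; apply: hGT.
have eq_sum : \sum_k 2 ^ #|color_class d k| = \sum_k 2 ^ #|color_class c k|.
  lia.
have eqG : connected_sets G = multicolored c.
  have mc_le : #|multicolored c| <= eta G by lia.
  by apply/eqP; rewrite eqEcard subG mc_le.
have aq k : (#|color_class c k| == q) || (#|color_class c k| == q.+1).
  have [_] := tanc; rewrite eq_sum eqxx => /esym/forallP; exact.
(* A pair with two colours is multicoloured, hence connected; the first step of a path from [x] to
   [y] inside it must be the edge [xy]. *)
have adjG x y : adj x y = (c x != c y).
  apply/idP/idP=> [/cP //|cxy].
  have : [set x; y] \in connected_sets G.
    rewrite eqG inE; apply/andP; split.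
      by apply/set0Pn; exists x; rewrite set21.
    apply/implyP=> /existsP[k /subsetP xyk].
    have := xyk x (set21 _ _); have := xyk y (set22 _ _).
    by rewrite !inE => /eqP cy /eqP cx; rewrite cx cy eqxx in cxy.
  rewrite inE => /andP[_ /forall_inP/(_ x (set21 _ _))].
  move=> /forall_inP/(_ y (set22 _ _))/connectP[[|z p]] /=.
    by move=> _ yx; rewrite yx eqxx in cxy.
  case/andP=> /and3P[_ + xz] _ _; rewrite !inE => /orP[] /eqP zE.
    by rewrite zE adj_irrefl in xz.
  by rewrite -zE.
(* Colours are first matched by class size through [s], then vertices within matched classes through
   [f]. *)
have [|s sb sP] := @balanced_reindexing _ K (fun k => #|color_class c k|)
    (fun k => #|color_class d k|) q (d y0) cardKL _ aq bq.
  by rewrite !sum_card_color_class.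
have s_inj := bij_inj sb.
have [k|f fb fP] := @color_preserving_bijection G T K (s \o c) d y0.
  have [s' s'K sK] := sb; rewrite -{2}(sK k) sP; apply: eq_card => x.
  by rewrite !inE /= -{1}(sK k) (inj_eq s_inj).
by exists f => // x y; rewrite dP !fP adjG (inj_eq s_inj).
Qed.
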